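(* There exists an absolute constant $C>0$ such that the following holds for every sufficiently large $n$ and every integer $N$ with \[ C n^2 \le N \le \exp\!\left(\frac{n}{C}\right). \] There exists a convex body $K \subseteq \mathbb{R}^n$ such that for every vector $\xi\in\mathbb{R}^n$ lying on the line segment connecting the barycenter of $K$ and the Santaló point of $K$, every polytope $P\subseteq\mathbb{R}^n$ satisfying \[ P \subseteq K-\xi \subseteq \frac{n}{C\log N}\,P \] has at least $N$ vertices.
   Context: A convex body is a compact convex set with nonempty interior. The barycenter of $K$ is its centroid $\frac{1}{|K|}\int_K x\,dx$. For a convex body $L$ containing the origin in its interior, its polar is $L^\circ=\{y:\langle y,z\rangle\le 1 \text{ for all } z\in L\}$. The Santaló point of a convex body $K$ is the unique point $x$ in the interior of $K$ at which $|K-x|\cdot|(K-x)^\circ|$ attains its minimum, where $|\cdot|$ denotes volume. *)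

(* Defs.v *)
From HB Require Import structures.
From mathcomp Require Import all_boot all_order all_algebra.
From mathcomp Require Import all_classical all_reals all_analysis.
From mathcomp Require Import Rstruct Rstruct_topology.
Set Implicit Arguments. Unset Strict Implicit. Unset Printing Implicit Defensive.
Import Order.TTheory GRing.Theory Num.Theory.
Import numFieldNormedType.Exports.
Local Open Scope classical_set_scope.
Local Open Scope ring_scope.

Section ConvexGeometry.
Variable R : realType.

Definition dotp (n : nat) (x y : 'rV[R]_n) : R := \sum_(i < n) x ord0 i * y ord0 i.

Definition convex_set (n : nat) (A : set 'rV[R]_n) : Prop :=
  forall x y, A x -> A y -> forall t : R, 0 <= t -> t <= 1 ->
    A (t *: x + (1 - t) *: y).

(* Convex body: compact convex set with nonempty interior
   (topology of 'rV[R]_n is the usual product/Euclidean one). *)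
Definition convex_body (n : nat) (K : set 'rV[R]_n) : Prop :=
  compact K /\ convex_set K /\ interior K !=set0.

(* Iterated Lebesgue integral over R^n of f, where a point of R^n is
   represented by its coordinate sequence s : nat -> R (coordinates 0..n-1);
   coordinate 0 is integrated outermost (Fubini–Tonelli). *)
Definition scons (t : R) (s : nat -> R) : nat -> R :=
  fun k => if k is k'.+1 then s k' else t.

Fixpoint iint (n : nat) (f : (nat -> R) -> \bar R) : \bar R :=
  match n with
  | 0 => f (fun _ => 0)
  | n'.+1 => (\int[@lebesgue_measure R]_t iint n' (fun s => f (scons t s)))%E
  end.

Definition row_of_seq (n : nat) (s : nat -> R) : 'rV[R]_n := \row_(i < n) s i.

Definition vol (n : nat) (A : set 'rV[R]_n) : \bar R :=
  iint n (fun s => (\1_A (row_of_seq n s))%:E).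

Definition barycenter (n : nat) (K : set 'rV[R]_n) : 'rV[R]_n :=
  \row_(i < n) (fine (iint n (fun s =>
        ((row_of_seq n s) ord0 i * \1_K (row_of_seq n s))%:E)) / fine (vol K)).

Definition translate (n : nat) (K : set 'rV[R]_n) (x : 'rV[R]_n) : set 'rV[R]_n :=
  [set y - x | y in K].

Definition dilate (n : nat) (lambda : R) (L : set 'rV[R]_n) : set 'rV[R]_n :=
  [set lambda *: p | p in L].

Definition polar (n : nat) (L : set 'rV[R]_n) : set 'rV[R]_n :=
  [set y | forall z, L z -> dotp y z <= 1].

Definition santalo_point (n : nat) (K : set 'rV[R]_n) (s : 'rV[R]_n) : Prop :=
  interior K s /\
  forall x, interior K x ->
    (vol (translate K s) * vol (polar (translate K s))
      <= vol (translate K x) * vol (polar (translate K x)))%E.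

Definition segment (n : nat) (a b : 'rV[R]_n) : set 'rV[R]_n :=
  [set (1 - t) *: a + t *: b | t in `[0, 1]%classic].

Definition conv_hull (n : nat) (V : seq 'rV[R]_n) : set 'rV[R]_n :=
  [set x | exists w : 'I_(size V) -> R,
     (forall i, 0 <= w i) /\ \sum_i w i = 1 /\
     x = \sum_i w i *: V`_i].

Definition polytope (n : nat) (P : set 'rV[R]_n) : Prop :=
  exists V : seq 'rV[R]_n, P = conv_hull V.

Definition vertex (n : nat) (P : set 'rV[R]_n) (v : 'rV[R]_n) : Prop :=
  P v /\ forall x y (t : R), P x -> P y -> 0 < t -> t < 1 ->
    v = t *: x + (1 - t) *: y -> x = v /\ y = v.

Definition has_at_least_vertices (n : nat) (P : set 'rV[R]_n) (N : nat) : Prop :=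
  exists vs : seq 'rV[R]_n, uniq vs /\ size vs = N /\ forall v, v \in vs -> vertex P v.

End ConvexGeometry.

(* Main.v *)
(* Let [K] in [R^(k+m+1)] be the join of a simplex with an [m]-cube placed in
   the hyperplane [h = 1]: [y >= 0], [|x_j| <= h], [sum y + h <= 1], with
   [m] of order [log N].  Both the barycenter and the Santalo point have height
   [h = O(m/n)], and so has every [xi] between them.

   If [P] is contained in [K - xi], which is contained in [lambda P], then for
   every sign vector [sigma] the cube vertex [sigma] contracts to a point of
   [P + xi] near height [1/lambda], which is much larger than the height of [xi].
   So some vertex of [P + xi], rescaled radially to [h = 1], is a point of the cube
   with inner product more than [3m/4] with [sigma].  By Chernoff's bound each
   vertex does this for at most [2^m exp(-m/4)] of the [sigma]; sign vectors with
   [<sigma, xi> < 0] are discarded, which costs at most half of them.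

   Barycenter: slicing by a coordinate [y_i = t] gives homothetic copies of the
   body of lower dimension, hence a recursion for the moments of [h].
   Santalo point [s]: the projective map [(y, x, h) |-> (y, x/2, h/2) / (1 - h/2)]
   preserves [K], and its dual maps the polar of [K - s'] into that of [K - s],
   where [s'] is the image of [s], by a map that is affine and triangular once [h]
   is the last coordinate.  Minimality of [s] then bounds its Jacobian.

   Only nonnegative integrands, monotonicity and triangular affine substitutions
   occur; since the integral of a nonnegative function is a supremum over simple
   functions, none of this needs measurability of the iterated integrals. *)
Require Import Defs.
From HB Require Import structures.
From mathcomp Require Import all_boot all_order all_algebra.
From mathcomp Require Import all_classical all_reals all_analysis.
From mathcomp Require Import Rstruct Rstruct_topology.
From mathcomp Require Import measurable_realfun beta_distribution.
From mathcomp Require Import ring lra zify.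
Import Order.TTheory GRing.Theory Num.Theory.
Import numFieldNormedType.Exports.
Local Open Scope classical_set_scope.
Local Open Scope ring_scope.
Set Implicit Arguments. Unset Strict Implicit. Unset Printing Implicit Defensive.

(** * Integrals of nonnegative functions without measurability *)

Import HBNNSimple.

(** The integral of a nonnegative function is the supremum over simple functions below it, and a
    simple function below [f] is below [g]. *)
Lemma ge0_le_integralT d (T : measurableType d) (R : realType)
    (mu : {measure set T -> \bar R}) (f g : T -> \bar R) :
  (forall x, (0 <= f x)%E) -> (forall x, (f x <= g x)%E) ->
  (\int[mu]_x f x <= \int[mu]_x g x)%E.
Proof.
move=> f0 fg; have g0 x : (0 <= g x)%E := le_trans (f0 x) (fg x).
rewrite !ge0_integralTE//; apply/ereal_sup_le => _ [h /= hf <-].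
exists h => //= x.
exact: le_trans (hf x) (fg x).
Qed.

Section affine_substitution.
Context {R : realType}.
Notation mu := (@lebesgue_measure R).

(** Lebesgue measure equals [a] times its pushforward under [t |-> a t + b]: the two agree on
    half-open intervals, and uniqueness does the rest. *)
Lemma ge0_measurable_integral_affine (f : measurableTypeR R -> \bar R) (a b : R) :
  0 < a -> measurable_fun [set: measurableTypeR R] f -> (forall x, 0 <= f x)%E ->
  (\int[mu]_t f t = a%:E * \int[mu]_t f (a * t + b)%R)%E.
Proof.
move=> a0 mf f0.
have mphi : measurable_fun [set: measurableTypeR R]
    (fun t : measurableTypeR R => (a * t + b)%R : measurableTypeR R).
  by apply: measurable_funD => //; exact: measurable_funM.
pose phi : {mfun measurableTypeR R >-> measurableTypeR R} :=
  HB.pack (fun t : measurableTypeR R => (a * t + b)%R : measurableTypeR R)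
    (isMeasurableFun.Build _ _ _ _ _ mphi).
have E A : measurable A ->
    mu A = mscale (NngNum (ltW a0)) (pushforward mu phi) A.
  move=> mA; apply: lebesgue_measure_unique => //= _ [[x y]] _ <-.
  rewrite /mscale /pushforward/=.
  have phixy : phi @^-1` `]x, y]%classic = `](x - b) / a, (y - b) / a]%classic.
    apply/seteqP; split=> t /=; rewrite !in_itv/= ltr_pdivrMr// ler_pdivlMr//;
      rewrite ltrBlDr lerBrDr (mulrC t); done.
  rewrite -[X in (_ = _ * mu X)%E]/(phi @^-1` `]x, y]%classic) phixy.
  rewrite !lebesgue_measure_itv/= !lte_fin ltr_pM2r ?invr_gt0//.
  rewrite ltrD2r; case: ifPn => _; last by rewrite mule0.
  rewrite -!EFinB -EFinM; congr EFin; field.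
  by rewrite gt_eqF.
rewrite (eq_measure_integral (mscale (NngNum (ltW a0)) (pushforward mu phi))); last first.
  by move=> A mA _; exact: E.
rewrite ge0_integral_mscale//= ge0_integral_pushforward//.
Qed.

(** A simple function [h] below the left integrand transports to [g t = h ((t - b) / a) / c], which
    is measurable and lies below [f]. The measurable substitution is applied to [g] only. *)
Lemma ge0_le_integral_affine (f : R -> \bar R) (a b c : R) : 0 < a -> 0 < c ->
  (forall x, 0 <= f x)%E ->
  (\int[mu]_t (c%:E * f (a * t + b)%R) <= (c / a)%:E * \int[mu]_t f t)%E.
Proof.
move=> a0 c0 f0.
rewrite ge0_integralTE; first last.
  by move=> x; rewrite mule_ge0// lee_fin ltW.
apply/ge_ereal_sup => _ /= [h /= hf <-].
have := integral_nnsfun mu measurableT h; rewrite patch_setT => <-.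
pose g (t : measurableTypeR R) : \bar R := ((c^-1)%:E * (h ((t - b) / a))%:E)%E.
have mg : measurable_fun [set: measurableTypeR R] g.
  have m1 : measurable_fun [set: measurableTypeR R]
      (fun t : measurableTypeR R => ((t - b) / a)%R : measurableTypeR R).
    by apply: measurable_funM => //; exact: measurable_funB.
  apply: measurable_funeM; apply/measurable_EFinP.
  exact: (measurableT_comp (measurable_funPT h) m1).
have g0 t : (0 <= g t)%E by rewrite mule_ge0// lee_fin ?fun_ge0// invr_ge0 ltW.
have -> : (\int[mu]_t (h t)%:E = (c / a)%:E * \int[mu]_t g t)%E.
  rewrite (@ge0_measurable_integral_affine g a b)// muleA -EFinM.
  rewrite divfK ?gt_eqF// -ge0_integralZl//; last 2 first.
  - have m1 : measurable_fun [set: measurableTypeR R]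
        (fun t : measurableTypeR R => (a * t + b)%R : measurableTypeR R).
      by apply: measurable_funD => //; exact: measurable_funM.
    exact: (measurableT_comp mg m1).
  - by rewrite lee_fin ltW.
  apply: eq_integral => t _; rewrite /g -!EFinM mulrA divff ?gt_eqF// mul1r.
  by rewrite addrK (mulrC a) mulfK// gt_eqF.
rewrite lee_pmul2l ?lte_fin ?divr_gt0// ?fin_numE//.
apply: ge0_le_integralT => // t; rewrite /g.
rewrite lee_pdivrMl//; apply: le_trans (hf _) _.
by rewrite mulrC divfK ?gt_eqF// subrK.
Qed.

(** The missing inequality is the previous one for the inverse substitution, with slope [a^-1],
    shift [- b / a] and factor [c^-1]. *)
Lemma ge0_integral_affine (f : R -> \bar R) (a b c : R) : 0 < a -> 0 < c ->
  (forall x, 0 <= f x)%E ->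
  (\int[mu]_t (c%:E * f (a * t + b)%R) = (c / a)%:E * \int[mu]_t f t)%E.
Proof.
move=> a0 c0 f0; apply/eqP; rewrite eq_le ge0_le_integral_affine//=.
set g := fun t => (c%:E * f (a * t + b)%R)%E.
have g0 x : (0 <= g x)%E by rewrite mule_ge0// lee_fin ltW.
have := @ge0_le_integral_affine g (a^-1) (- b / a) c^-1.
rewrite !invr_gt0 => /(_ a0 c0 g0).
rewrite invrK (_ : c^-1 * a = (c / a)^-1); last by rewrite invf_div mulrC.
rewrite lee_pdivlMl ?divr_gt0//.
congr (_ * _ <= _)%E; apply: eq_integral => t _; rewrite /g muleA -EFinM.
rewrite mulVf ?gt_eqF// mul1e; congr f; field; exact: lt0r_neq0.
Qed.

End affine_substitution.

(** * Iterated integrals: triangular substitutions and boxes *)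

Section iterated_integral.
Context {R : realType}.
Implicit Types (f g : (nat -> R) -> \bar R) (s : nat -> R).

Lemma iint_ge0 n f : (forall s, 0 <= f s)%E -> (0 <= iint n f)%E.
Proof.
elim: n f => [|n IHn] f f0 //=.
by apply: integral_ge0 => t _; exact: IHn.
Qed.

Lemma le_iint n f g : (forall s, 0 <= f s)%E -> (forall s, f s <= g s)%E ->
  (iint n f <= iint n g)%E.
Proof.
elim: n f g => [|n IHn] f g f0 fg //=.
by apply: ge0_le_integralT => t; [exact: iint_ge0|exact: IHn].
Qed.

Lemma iint0 n : iint n (fun _ : nat -> R => 0%E) = 0%E.
Proof. by elim: n => //= n ->; rewrite integral0_eq. Qed.

(** [iint n] sets all coordinates from [n] on to 0, whereas a substitution may move them; this
    condition makes that harmless. *)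
Definition depends_below {T} n (F : (nat -> R) -> T) :=
  forall s s', (forall i, (i < n)%N -> s i = s' i) -> F s = F s'.

Lemma depends_below_indic n (A : set (nat -> R)) :
  depends_below n A -> depends_below n (\1_A : (nat -> R) -> R).
Proof.
move=> AP s s' /AP AE; rewrite !indicE; congr (nat_of_bool _)%:R.
by apply/idP/idP => /set_mem H; apply/mem_set; rewrite ?AE// -AE.
Qed.

(** Induction from the outermost coordinate: once coordinate 0 is fixed to [t], the remaining map is
    again triangular, and coordinate 0 itself undergoes a one-variable affine substitution. *)
Lemma iint_triangular n (a : nat -> R) (b : nat -> (nat -> R) -> R) f :
  (forall i, 0 < a i) -> (forall i, depends_below i (b i)) ->
  depends_below n f -> (forall s, 0 <= f s)%E ->
  iint n (fun s => f (fun i => a i * s i + b i s)) =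
  (((\prod_(i < n) a i)^-1)%:E * iint n f)%E.
Proof.
elim: n a b f => [|n IHn] a b f a0 bP fP f0 /=.
  by rewrite big_ord0 invr1 mul1e; exact: fP.
(* The shift of coordinate 0 may depend on no coordinate, so it is a constant. *)
have b0E s s' : b 0%N s = b 0%N s' by exact: bP.
pose b' t i s := b i.+1 (scons t s).
have b'P t i : depends_below i (b' t i).
  by move=> s s' ss'; apply: bP => -[|j]//=; exact: ss'.
have fP' t : depends_below n (fun s => f (scons t s)).
  by move=> s s' ss'; apply: fP => -[|j]//=; exact: ss'.
pose b0 := b 0%N (fun=> 0).
transitivity (\int[@lebesgue_measure R]_t
  (((\prod_(i < n) a i.+1)^-1)%:E *
   (fun u => iint n (fun s => f (scons u s))) (a 0%N * t + b0)%R))%E.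
  apply: eq_integral => t _ /=.
  rewrite -(IHn (fun i => a i.+1) (b' t) (fun s => f (scons _ s)))//.
  congr iint; apply: funext => s; apply: fP => -[|j]//= _.
  by rewrite (b0E _ (fun=> 0)).
rewrite (@ge0_integral_affine _ (fun u => iint n (fun s => f (scons u s))))//;
  last 2 first.
- by rewrite invr_gt0; apply: prodr_gt0.
- by move=> u; exact: iint_ge0.
by rewrite big_ord_recl/= invfM mulrC.
Qed.

Lemma iint_scale n (c : R) f : 0 < c -> depends_below n f ->
  (forall s, 0 <= f s)%E ->
  iint n (fun s => f (fun i => c * s i)) = ((c ^- n)%:E * iint n f)%E.
Proof.
move=> c0 fP f0.
have := @iint_triangular n (fun=> c) (fun _ _ => 0) f.
rewrite prodr_const card_ord => <-//.
by congr iint; apply: funext => s; congr f; apply: funext => i; rewrite addr0.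
Qed.

Lemma integral_indic_interval (a b : R) : a <= b ->
  (\int[@lebesgue_measure R]_t (\1_`[a, b]%classic t)%:E = (b - a)%:E)%E.
Proof.
move=> ab; rewrite integral_indic//= setIT lebesgue_measure_itv/= lte_fin.
by have [//|ba] := ltP; congr EFin; apply/esym/eqP; rewrite subr_eq0 eq_le ba.
Qed.

(** Comparison with boxes is the source of all positivity and finiteness of volumes below. *)
Lemma iint_box n (c : nat -> R) (r : R) : 0 <= r ->
  iint n (fun s => (\1_[set s | forall i, (i < n)%N -> `|s i - c i| <= r] s)%:E) =
  ((2 * r) ^+ n)%:E.
Proof.
move=> r0; elim: n c => [|n IHn] c /=.
  by rewrite indicE mem_set//= expr0.
transitivity (\int[@lebesgue_measure R]_t
    (((2 * r) ^+ n)%:E * (\1_(`[c 0%N - r, c 0%N + r]%classic) t)%:E))%E.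
  apply: eq_integral => t _; rewrite -(IHn (fun i => c i.+1)).
  have [tc|tc] := boolP (t \in `[c 0%N - r, c 0%N + r]).
    rewrite indicE mem_set//= mule1; congr iint; apply: funext => s.
    congr (_%:R%:E); congr (nat_of_bool _).
    apply/idP/idP => /set_mem/= H; apply/mem_set => i.
      by move=> i_lt; exact: (H i.+1).
    by case: i => [_|i] /=; [rewrite ler_distl|exact: H];
      move: tc; rewrite in_itv/=; lra.
  rewrite indicE memNset//= ?mule0; last exact/negP.
  rewrite -(iint0 n); congr iint; apply: funext => s.
  rewrite indicE memNset//= => /(_ 0%N isT)/=; apply/negP; apply: contra tc.
  by rewrite ler_distl in_itv/=.
rewrite ge0_integralZl//; last 2 first.
- by apply/measurable_EFinP; exact: measurable_indic.
- by rewrite lee_fin exprn_ge0// mulr_ge0.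
rewrite integral_indic_interval; last by lra.
by rewrite -EFinM exprSr; congr (_ * _)%:E; lra.
Qed.

Lemma iintZ n (c : R) (f : (nat -> R) -> \bar R) : 0 < c ->
  (forall s, 0 <= f s)%E -> iint n (fun s => c%:E * f s)%E = (c%:E * iint n f)%E.
Proof.
move=> c0; elim: n f => [|n IHn] f f0 //=.
have := @ge0_integral_affine _ (fun t => iint n (fun s => f (scons t s))) 1 0 c.
rewrite divr1 => <-//; last by move=> t; exact: iint_ge0.
apply: eq_integral => t _; rewrite IHn//; congr (_ * iint _ _)%E.
by apply: funext => s; rewrite mul1r addr0.
Qed.

End iterated_integral.

(** * The barycenter *)

Section cone_over_cube.
Context {R : realType}.

Lemma ge0_integral_onemXn (n : nat) :
  (\int[@lebesgue_measure R]_t ((1 - t) ^+ n * \1_`[0%R, 1%R]%classic t)%:E =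
  (n.+1%:R^-1)%:E)%E.
Proof.
transitivity (\int[@lebesgue_measure R]_(t in `[0%R, 1%R]) ((1 - t) ^+ n)%:E)%E.
  rewrite [RHS]integral_mkcond restrict_EFin patch_indic.
  by apply: eq_integral => t _ /=.
rewrite (@continuous_FTC2 _ _ (fun x => (1 - x) ^+ n.+1 / - n.+1%:R))//=.
- rewrite subrr expr0n/= mul0r subr0 expr1n mul1r -EFinB.
  by rewrite sub0r -invrN opprK.
- by apply: continuous_in_subspaceT => x x01; exact: continuous_onemXn.
- exact: derivable_oo_LRcontinuous_onemXnMr.
- move=> x x01; rewrite derive1Mr//; last exact: onemXn_derivable.
  by rewrite derive_onemXn mulrAC divff// mul1r.
Qed.

(* Coordinates come in the order [y_0 .. y_(k-1), x_0 .. x_(m-1), h]. *)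
Definition seq_body (k m : nat) (u : R) : set (nat -> R) :=
  [set s | [/\ forall i, (i < k)%N -> 0 <= s i,
               forall j, (j < m)%N -> `|s (k + j)%N| <= s (k + m)%N,
               0 <= s (k + m)%N &
               \sum_(i < k) s i + s (k + m)%N <= u]].

Lemma seq_body_scons k m u t s :
  seq_body k.+1 m u (scons t s) <-> 0 <= t /\ seq_body k m (u - t) s.
Proof.
split.
  move=> [y0 xh h0]; rewrite big_ord_recl/= => le_u.
  split; first exact: (y0 0%N).
  split => //; last by lra.
  by move=> i ik; exact: (y0 i.+1).
move=> [t0 [y0 xh h0 le_u]]; split => //.
- by case=> [|i] //= ik; exact: y0.
- by rewrite big_ord_recl/=; lra.
Qed.

Lemma seq_body_scale k m c u s : 0 < c ->
  seq_body k m u (fun i => c * s i) <-> seq_body k m (c^-1 * u) s.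
Proof.
move=> c0; rewrite /seq_body/= -mulr_sumr -mulrDr ler_pdivlMl// pmulr_rge0//.
split=> -[y0 xh h0 le_u]; split=> // i ilt; move: (y0 i) (xh i).
- by rewrite pmulr_rge0// => ->.
- by rewrite normrM (gtr0_norm c0) ler_pM2l// => _ ->.
- by rewrite pmulr_rge0// => ->.
- by rewrite normrM (gtr0_norm c0) ler_pM2l// => _ ->.
Qed.

Lemma seq_body_depends k m u : depends_below (k + m).+1 (seq_body k m u).
Proof.
have half s s' : (forall i, (i < (k + m).+1)%N -> s i = s' i) ->
    seq_body k m u s -> seq_body k m u s'.
  move=> ss' [y0 xh h0 le_u].
  have hE := ss' _ (ltnSn (k + m)).
  split; rewrite -?hE//.
  - by move=> i ik; rewrite -ss' ?y0//; lia.
  - by move=> j jm; rewrite -ss' ?xh//; lia.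
  - apply: le_trans le_u; rewrite lerD2r; apply: ler_sum => i _.
    by rewrite ss'//; have := ltn_ord i; lia.
move=> s s' ss'; apply/propext; split; apply: half => // i il.
by rewrite ss'.
Qed.

Lemma seq_body_bound k m u s : seq_body k m u s ->
  forall i, (i < (k + m).+1)%N -> `|s i| <= u.
Proof.
move=> [y0 xh h0 le_u] i.
have sum0 : 0 <= \sum_(i < k) s i by apply: sumr_ge0 => j _; exact: y0.
rewrite ltnS leq_eqVlt => /predU1P[->|ikm]; first by rewrite ger0_norm//; lra.
have [ik|ki] := ltnP i k.
  rewrite ger0_norm ?y0//; apply: le_trans le_u.
  rewrite (bigD1 (Ordinal ik))//= -addrA lerDl addr_ge0//.
  by apply: sumr_ge0 => j _; exact: y0.
have := xh (i - k)%N; rewrite subnKC// => /(_ _)/le_trans; apply; first by lia.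
lra.
Qed.

(** The moment of order [e] of the height: [e = 0] gives the volume, [e = 1] the numerator of the
    last barycenter coordinate. *)
Definition body_moment (e k m : nat) (u : R) : \bar R :=
  iint (k + m).+1 (fun s => (s (k + m)%N ^+ e * \1_(seq_body k m u) s)%:E).

Lemma moment_ge0 e k m u s : 0 <= s (k + m)%N ^+ e * \1_(seq_body k m u) s.
Proof.
rewrite indicE; have [/set_mem[_ _ h0 _]|_] := boolP (s \in seq_body k m u).
  by rewrite mulr1 exprn_ge0.
by rewrite mulr0.
Qed.

Lemma body_moment_ge0 e k m u : (0 <= body_moment e k m u)%E.
Proof. by apply: iint_ge0 => s; rewrite lee_fin moment_ge0. Qed.

Lemma body_moment_le e k m u : 0 <= u -> u <= 1 ->
  (body_moment e k m u <= ((2 * u) ^+ (k + m).+1)%:E)%E.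
Proof.
move=> u0 u1; rewrite -(iint_box (k + m).+1 (fun=> 0) u0).
apply: le_iint => s; rewrite lee_fin ?moment_ge0//.
rewrite !indicE; have [/set_mem sK|_] := boolP (s \in seq_body k m u); last first.
  by rewrite mulr0.
have sb := seq_body_bound sK; case: sK => _ _ h0 _.
rewrite mulr1 mem_set/=; last by move=> i /sb; rewrite subr0.
by rewrite exprn_ile1//; have := sb _ (ltnSn _); rewrite ger0_norm//; lra.
Qed.

Lemma body_moment_fin e k m u : 0 <= u -> u <= 1 ->
  body_moment e k m u \is a fin_num.
Proof.
move=> u0 u1; rewrite ge0_fin_numE ?body_moment_ge0//.
by apply: le_lt_trans (body_moment_le e k m u0 u1) _; rewrite ltry.
Qed.

Lemma body_moment_scale e k m u : 0 <= u -> u <= 1 ->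
  body_moment e k m u = ((u ^+ ((k + m).+1 + e))%:E * body_moment e k m 1)%E.
Proof.
rewrite le_eqVlt => /predU1P[<- _|u0 u1].
  (* Rescaling by [u^-1] makes no sense at [u = 0]; there the body lies in a box of side 0. *)
  rewrite expr0n/= mul0e; apply/eqP; rewrite eq_le body_moment_ge0 andbT.
  by have := @body_moment_le e k m 0; rewrite mulr0 expr0n/=; apply.
have sc := @iint_scale R (k + m).+1 u^-1
  (fun s => (s (k + m)%N ^+ e * \1_(seq_body k m 1) s)%:E).
rewrite addnC exprD EFinM -muleA -[X in (_ * X)%E](_ :
  (u^-1 ^- (k + m).+1)%:E * body_moment e k m 1 = _)%E; last first.
  by rewrite exprVn invrK.
rewrite -sc ?invr_gt0//; last 2 first.
- move=> s s' ss'; rewrite (ss' _ (ltnSn _)).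
  by rewrite (depends_below_indic (@seq_body_depends k m 1) ss').
- by move=> s; rewrite lee_fin moment_ge0.
rewrite -iintZ ?exprn_gt0//; last first.
  move=> s; rewrite lee_fin; have := @moment_ge0 e k m 1 (fun i => u^-1 * s i).
  exact.
congr iint; apply: funext => s; rewrite -EFinM; congr EFin.
rewrite exprMn exprVn !mulrA divff ?mul1r; last by rewrite expf_neq0// gt_eqF.
congr (_ * _); rewrite !indicE; congr (nat_of_bool _)%:R.
by apply/idP/idP => /set_mem H; apply/mem_set; move: H;
  rewrite seq_body_scale ?invr_gt0// invrK mulr1.
Qed.

(** The slice [y_0 = t] is the body of one dimension less scaled by [1 - t], so its moment carries
    the factor [(1 - t)^(k + m + 1 + e)]; integrating this over [[0, 1]] gives the coefficient. *)
Lemma body_moment_rec e k m : body_moment e k.+1 m 1 =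
  ((((k + m).+1 + e).+1%:R^-1)%:E * body_moment e k m 1)%E.
Proof.
rewrite -(ge0_integral_onemXn ((k + m).+1 + e)) muleC -ge0_integralZl//; last 3 first.
- apply/measurable_EFinP; apply: measurable_funM; last exact: measurable_indic.
  by apply: measurable_funX; exact: measurable_funB.
- move=> t _; rewrite lee_fin indicE.
  have [/set_mem|_] := boolP (t \in _); last by rewrite mulr0.
  by rewrite /= in_itv/= => t01; rewrite mulr1 exprn_ge0//; lra.
- exact: body_moment_ge0.
apply: eq_integral => t _.
rewrite -[LHS]/(iint (k + m).+1
  (fun s => (s (k + m)%N ^+ e * \1_(seq_body k.+1 m 1) (scons t s))%:E)).
rewrite indicE; have [/set_mem tI|t01] := boolP (t \in _).
  have {tI}t01 : 0 <= t <= 1 by move: tI; rewrite /= in_itv.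
  rewrite mulr1 muleC -body_moment_scale; [|lra|lra].
  congr iint; apply: funext => s.
  congr (_ * _)%:E; rewrite !indicE; congr (nat_of_bool _)%:R.
  apply/idP/idP => /set_mem H; apply/mem_set; move: H; rewrite seq_body_scons.
    by case.
  by split => //; lra.
rewrite mulr0 mule0 -(iint0 (k + m).+1); congr iint; apply: funext => s.
rewrite indicE memNset ?mulr0// seq_body_scons => -[t0 sK].
move/negP: t01; apply; apply/mem_set; rewrite /= in_itv/= t0/=.
by have := seq_body_bound sK (ltnSn _); move/(le_trans (normr_ge0 _)); lra.
Qed.

(** For [k = 0] the ratio is 1 and [h <= 1] suffices. By the recursion each further [y] coordinate
    multiplies the quotient of the two moments by [(k + m + 2) / (k + m + 3)], and the product
    telescopes. *)
Lemma body_moment1_le k m :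
  (body_moment 1 k m 1 <= ((m.+2%:R / (k + m).+2%:R)%:E * body_moment 0 k m 1))%E.
Proof.
elim: k => [|k IHk].
  rewrite add0n divff// mul1e; apply: le_iint => s; rewrite lee_fin ?moment_ge0//.
  rewrite !indicE; have [/set_mem sK|_] := boolP (s \in _); last by rewrite !mulr0.
  rewrite !mulr1 expr1 expr0.
  by have := seq_body_bound sK (ltnSn _); move/(le_trans (ler_norm _)).
rewrite !body_moment_rec muleA -EFinM.
apply: le_trans (lee_wpmul2l _ IHk) _; first by rewrite lee_fin invr_ge0.
rewrite muleA -EFinM; apply: lee_wpmul2r; first exact: body_moment_ge0.
rewrite lee_fin addn1 addn0 addSn mulrCA [leRHS]mulrAC -[leRHS]mulrA.
by rewrite [X in _ * X]mulrC.
Qed.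

End cone_over_cube.

(** * Volume, interior and inner product for row vectors *)

Section volume_of_row_sets.
Context {R : realType} {n : nat}.
Implicit Types (A : set 'rV[R]_n.+1) (v c : 'rV[R]_n.+1).

Definition seq_of_row v : nat -> R := fun i => v ord0 (inord i).

Lemma row_of_seqE (s : nat -> R) (i : 'I_n.+1) : row_of_seq n.+1 s ord0 i = s i.
Proof. by rewrite mxE. Qed.

Lemma seq_of_rowE v (i : 'I_n.+1) : seq_of_row v i = v ord0 i.
Proof. by rewrite /seq_of_row inord_val. Qed.

Lemma seq_of_rowK s i : (i < n.+1)%N -> seq_of_row (row_of_seq n.+1 s) i = s i.
Proof. by move=> i_lt; rewrite /seq_of_row row_of_seqE inordK. Qed.

Lemma row_depends A : depends_below n.+1 (fun s => (\1_A (row_of_seq n.+1 s) : R)%:E).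
Proof.
move=> s s' ss'; congr (\1_A _)%:E; apply/rowP => i.
by rewrite !row_of_seqE ss'.
Qed.

Lemma indic_ge0E A v : (0 <= (\1_A v : R)%:E)%E.
Proof. by rewrite lee_fin indicE. Qed.

Lemma vol_ge0 A : (0 <= vol A)%E.
Proof. by apply: iint_ge0 => s; exact: indic_ge0E. Qed.

Lemma le_indic (T U : Type) (B : set T) (C : set U) (x : T) (y : U) : (B x -> C y) ->
  (\1_B x : R) <= \1_C y.
Proof.
move=> BC; rewrite !indicE; have [/set_mem/BC Cy|_] := boolP (x \in B).
  by rewrite mem_set.
by rewrite ler0n.
Qed.

Lemma vol_translate A x : vol (translate A x) = vol A.
Proof.
rewrite /vol.
have := @iint_triangular R n.+1 (fun=> 1) (fun i _ => seq_of_row x i)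
  (fun s => (\1_A (row_of_seq n.+1 s))%:E) (fun=> ltr01) (fun _ _ _ _ => erefl)
  (@row_depends A) (fun=> indic_ge0E A _).
rewrite prodr_const expr1n invr1 mul1e => <-.
congr iint; apply: funext => s; congr EFin; apply/le_anti/andP; split; apply: le_indic.
  move=> [y Ay yE].
  suff -> : row_of_seq n.+1 (fun i => 1 * s i + seq_of_row x i) = y by [].
  have -> : y = row_of_seq n.+1 s + x by rewrite -yE subrK.
  by apply/rowP => i; rewrite mxE [RHS]mxE row_of_seqE mul1r seq_of_rowE.
move=> Ay; exists (row_of_seq n.+1 (fun i => 1 * s i + seq_of_row x i)) => //.
by apply/rowP => i; rewrite 3!mxE row_of_seqE mul1r seq_of_rowE addrK.
Qed.

Lemma vol_box_ge A c (r : R) : 0 <= r ->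
  (forall v, (forall i, `|v ord0 i - c ord0 i| <= r) -> A v) ->
  (((2 * r) ^+ n.+1)%:E <= vol A)%E.
Proof.
move=> r0 bA; rewrite -(iint_box n.+1 (seq_of_row c) r0).
apply: le_iint => s; first by rewrite lee_fin indicE.
rewrite lee_fin; apply: le_indic => /= H; apply: bA => i.
by rewrite row_of_seqE -seq_of_rowE; exact: H.
Qed.

Lemma vol_box_le A (r : R) : 0 <= r ->
  (forall v, A v -> forall i, `|v ord0 i| <= r) ->
  (vol A <= ((2 * r) ^+ n.+1)%:E)%E.
Proof.
move=> r0 bA; rewrite -(iint_box n.+1 (fun=> 0) r0).
apply: le_iint => s; first by rewrite lee_fin indicE.
rewrite lee_fin; apply: le_indic => /= H i i_lt.
by have := bA _ H (Ordinal i_lt); rewrite row_of_seqE subr0.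
Qed.

(** Balls of the matrix topology are open sup-norm cubes; halving the radius passes to closed
    cubes. *)
Lemma interior_boxP A v : interior A v <->
  exists2 e : R, 0 < e &
    forall w : 'rV[R]_n.+1, (forall i, `|w ord0 i - v ord0 i| <= e) -> A w.
Proof.
split.
  move=> /nbhs_ballP[e /= e0 eA]; exists (e / 2); first by rewrite divr_gt0.
  move=> w wv; apply: eA; split => // i j; rewrite ord1 /ball/= distrC.
  by apply: le_lt_trans (wv j) _; lra.
move=> [e e0 eA]; apply/nbhs_ballP; exists e => //= w [_ wv]; apply: eA => i.
by have := wv ord0 i; rewrite /ball/= distrC => /ltW.
Qed.

Lemma dotpDr v (w c : 'rV[R]_n.+1) : dotp v (w + c) = dotp v w + dotp v c.
Proof. by rewrite -big_split; apply: eq_bigr => i _; rewrite mxE mulrDr. Qed.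

Lemma dotpZr v (a : R) (w : 'rV[R]_n.+1) : dotp v (a *: w) = a * dotp v w.
Proof. by rewrite mulr_sumr; apply: eq_bigr => i _; rewrite mxE mulrCA. Qed.

Lemma dotpC v (w : 'rV[R]_n.+1) : dotp v w = dotp w v.
Proof. by apply: eq_bigr => i _; rewrite mulrC. Qed.

Lemma dotpBr v (w c : 'rV[R]_n.+1) : dotp v (w - c) = dotp v w - dotp v c.
Proof. by rewrite dotpDr -scaleN1r dotpZr mulN1r. Qed.

Lemma dotp_delta v i : dotp v (delta_mx ord0 i) = v ord0 i.
Proof.
rewrite /dotp (bigD1 i)//= mxE !eqxx mulr1 big1 ?addr0// => j ji.
by rewrite mxE eqxx (negbTE ji) mulr0.
Qed.

End volume_of_row_sets.

(** * The join as a convex body, and the height of its barycenter *)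

Section cone_body.
Context {R : realType} (k m : nat).
Notation n := (k + m).+1.
Implicit Types v w : 'rV[R]_n.

Definition cone_body : set 'rV[R]_n := [set v | seq_body k m 1 (seq_of_row v)].

Lemma cone_body_row s : cone_body (row_of_seq n s) = seq_body k m 1 s.
Proof. by apply: seq_body_depends => i ilt; rewrite seq_of_rowK. Qed.

Lemma indic_cone_body s :
  \1_cone_body (row_of_seq n s) = \1_(seq_body k m 1) s :> R.
Proof. by apply/le_anti/andP; split; apply: le_indic; rewrite cone_body_row. Qed.

Lemma vol_cone_body : vol cone_body = body_moment 0 k m 1.
Proof.
rewrite /vol /body_moment; congr iint; apply: funext => s.
by rewrite indic_cone_body expr0 mul1r.
Qed.

Lemma barycenter_height :
  barycenter cone_body ord0 ord_max <= m.+2%:R / (k + m).+2%:R.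
Proof.
rewrite mxE vol_cone_body.
rewrite (_ : iint _ _ = body_moment 1 k m 1); last first.
  rewrite /body_moment; congr iint; apply: funext => s.
  by rewrite row_of_seqE indic_cone_body.
have fin e : body_moment e k m (1 : R) \is a fin_num by exact: body_moment_fin.
have := body_moment1_le (R := R) k m.
have := body_moment_ge0 (R := R) 0 k m 1.
rewrite -(fineK (fin 0%N)) -(fineK (fin 1%N)) -EFinM !lee_fin.
(* If the volume were 0, the quotient would be 0 by the convention for inverses, and the bound would
   still hold. *)
rewrite le_eqVlt => /predU1P[<- _|I0 le10]; last by rewrite ler_pdivrMr.
by rewrite invr0 mulr0 divr_ge0.
Qed.

Lemma cone_body_convex : Defs.convex_set cone_body.
Proof.
move=> x y [x1 x2 x3 x4] [y1 y2 y3 y4] t t0 t1.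
pose z := row_of_seq n (fun i => t * seq_of_row x i + (1 - t) * seq_of_row y i).
have -> : t *: x + (1 - t) *: y = z.
  by apply/rowP => i; rewrite !mxE !seq_of_rowE.
have t1' : 0 <= 1 - t by rewrite subr_ge0.
rewrite /z cone_body_row; split.
- by move=> i ik; rewrite addr_ge0// mulr_ge0 ?x1 ?y1.
- move=> j jm; apply: le_trans (ler_normD _ _) _.
  rewrite !normrM (ger0_norm t0) (ger0_norm t1').
  by apply: lerD; apply: ler_wpM2l => //; [exact: x2|exact: y2].
- by rewrite addr_ge0// mulr_ge0.
- rewrite big_split/= -!mulr_sumr addrACA -!mulrDr.
  by apply: le_trans (lerD (ler_wpM2l t0 x4) (ler_wpM2l t1' y4)) _; lra.
Qed.

Lemma cone_body_bound v : cone_body v -> forall i, `|v ord0 i| <= 1.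
Proof. by move=> /seq_body_bound vb i; rewrite -seq_of_rowE; exact: vb. Qed.

Lemma ler_sum_dist (s t : nat -> R) (e : R) :
  (forall i, (i < k)%N -> `|s i - t i| <= e) ->
  \sum_(i < k) s i <= \sum_(i < k) t i + k%:R * e.
Proof.
move=> ste; rewrite -lerBlDl -sumrB mulr_natl -[X in _ *+ X]card_ord -sumr_const.
apply: ler_sum => i _.
by have := ste i (ltn_ord i); apply: le_trans; exact: ler_norm.
Qed.

Lemma cone_body_closed : closed cone_body.
Proof.
move=> v clv.
have near e : 0 < e -> exists2 s : nat -> R, seq_body k m 1 s &
    forall i, (i < n)%N -> `|s i - seq_of_row v i| <= e.
  move=> e0; have /clv[w [Kw [_ vw]]] : nbhs v (ball v e) by exact: nbhsx_ballx.
  exists (seq_of_row w) => // i ilt.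
  by have := vw ord0 (inord i); rewrite /ball/= distrC => /ltW.
split.
- move=> i ik; rewrite leNgt; apply/negP => vi.
  have [|s [s1 _ _ _] /(_ i)] := near (- seq_of_row v i / 2); first by lra.
  rewrite ler_norml => /(_ _)/andP[]; first by lia.
  by have := s1 _ ik; lra.
- move=> j jm; rewrite leNgt; apply/negP => vj.
  have [|s [_ s2 _ _] sv] :=
    near ((`|seq_of_row v (k + j)%N| - seq_of_row v (k + m)%N) / 4); first by lra.
  have := sv (k + m)%N (ltnSn _); rewrite ler_norml => /andP[].
  have := sv (k + j)%N; rewrite distrC => /(_ _)/(le_trans (lerB_dist _ _)).
  have /[swap] /[apply] : (k + j < n)%N by lia.
  by have := s2 _ jm; lra.
- rewrite leNgt; apply/negP => vi.
  have [|s [_ _ s3 _] /(_ _ (ltnSn _))] := near (- seq_of_row v (k + m)%N / 2).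
    by lra.
  by rewrite ler_norml => /andP[]; lra.
rewrite leNgt; apply/negP; set S := \sum_(i < k) _ => vS.
(* The excess over 1 is [(k + 2) e]; an [e]-close point loses at most [(k + 1) e] of it and so still
   violates the constraint. *)
pose e := (S + seq_of_row v (k + m)%N - 1) / k.+2%:R.
have e0 : 0 < e by rewrite divr_gt0//; lra.
have [s [_ _ _ s4] sv] := near e e0.
have := sv _ (ltnSn (k + m)); rewrite ler_norml => /andP[hs _].
have := @ler_sum_dist (seq_of_row v) s e; rewrite -/S => /(_ _) H.
have {}H : S <= \sum_(i < k) s i + k%:R * e.
  by apply: H => i ik; rewrite distrC; apply: sv; lia.
have : e * k.+2%:R = S + seq_of_row v (k + m)%N - 1 by rewrite divfK// pnatr_eq0.
rewrite -[k.+2%:R]natr1 -[k.+1%:R]natr1; lra.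
Qed.

Lemma cone_body_compact : compact cone_body.
Proof.
have boxc : compact [set v : 'rV[R]_n | forall i, v ord0 i \in `[(-1 : R), 1]].
  apply: (@rV_compact _ _ (fun=> `[(-1 : R), 1]%classic)) => _.
  exact: segment_compact.
apply: (subclosed_compact cone_body_closed boxc) => v /cone_body_bound vb i.
by have := vb i; rewrite ler_norml in_itv.
Qed.

(** A slack [e] in every constraint absorbs a perturbation [d] per coordinate: [|x_j| <= h] involves
    two coordinates, the sum constraint [k + 1] of them. *)
Lemma seq_body_near (s t : nat -> R) (e d : R) :
  (forall i, (i < k)%N -> e <= s i) ->
  (forall j, (j < m)%N -> `|s (k + j)%N| <= s (k + m)%N - e) ->
  e <= s (k + m)%N -> \sum_(i < k) s i + s (k + m)%N <= 1 - e ->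
  2 * d <= e -> k.+1%:R * d <= e -> 0 < d ->
  (forall i, (i < n)%N -> `|t i - s i| <= d) -> seq_body k m 1 t.
Proof.
move=> s1 s2 s3 s4 d1 d2 d0 ts.
have := ts (k + m)%N (ltnSn _); rewrite ler_norml => /andP[ht ht'].
split.
- move=> i ik; have := ts i; rewrite ler_norml => /(_ _)/andP[]; first by lia.
  by have := s1 _ ik; lra.
- move=> j jm; have := ts (k + j)%N => /(_ _)/(le_trans (lerB_dist _ _)).
  have /[swap] /[apply] : (k + j < n)%N by lia.
  by have := s2 _ jm; lra.
- lra.
have := @ler_sum_dist t s d; move=> /(_ _) H.
have {}H : \sum_(i < k) t i <= \sum_(i < k) s i + k%:R * d.
  by apply: H => i ik; apply: ts; lia.
by move: d2; rewrite -natr1; lra.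
Qed.

Lemma cone_body_interior : interior cone_body !=set0.
Proof.
pose e : R := 8^-1; pose d := e / k.+1%:R.
have d0 : 0 < d by rewrite divr_gt0// invr_gt0.
have dk : k.+1%:R * d = e by rewrite mulrC divfK// pnatr_eq0.
have kd : k%:R * d = e - d by move: dk; rewrite -natr1; lra.
have kd0 : 0 <= k%:R * d by rewrite mulr_ge0// ltW.
(* The centre has [y_i = 2 d], [x = 0], [h = 1/2]. Since [d = 1 / (8 (k + 1))], the [y_i] sum to
   less than [1/4], and every constraint has slack at least [d]. *)
pose s i : R := if (i < k)%N then 2 * d else if (i == k + m)%N then 2^-1 else 0.
have sm : s (k + m)%N = 2^-1 by rewrite /s eqxx; case: ifP => //; lia.
pose d' := d / 2 / k.+1%:R.
have d'0 : 0 < d' by rewrite divr_gt0 ?ltr0n// divr_gt0.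
have dk' : k.+1%:R * d' = d / 2 by rewrite mulrC divfK// pnatr_eq0.
have kd' : 0 <= k%:R * d' by rewrite mulr_ge0// ltW.
exists (row_of_seq n s); apply/interior_boxP; exists d' => //.
move=> w ws; apply: (@seq_body_near s _ d d') => //.
- by move=> i ik; rewrite /s ik; lra.
- move=> j jm; rewrite sm /s ifF; last by lia.
  by rewrite ifF ?normr0; [rewrite /e in kd; lra|lia].
- by rewrite sm; rewrite /e in kd; lra.
- rewrite sm (eq_bigr (fun=> 2 * d)); last by move=> i _; rewrite /s ltn_ord.
  by rewrite sumr_const card_ord -mulr_natl; rewrite /e in kd; lra.
- by move: dk'; rewrite -natr1; lra.
- by rewrite dk'; lra.
move=> i ilt; have := ws (Ordinal ilt); rewrite row_of_seqE.
by rewrite -seq_of_rowE.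
Qed.

Lemma cone_body_convex_body : convex_body cone_body.
Proof.
split; first exact: cone_body_compact.
by split; [exact: cone_body_convex|exact: cone_body_interior].
Qed.

End cone_body.

(** * The Santalo point *)

Section santalo.
Context {R : realType} (k m : nat).
Notation n := (k + m).+1.
Notation K := (@cone_body R k m).
Implicit Types v w s : 'rV[R]_n.

(** Three points of the cube around [s] suffice: all coordinates lowered by [e], only the height
    lowered by [e], only the height raised by [e]. *)
Lemma cone_body_slack s (e : R) : 0 < e ->
  (forall w, (forall i, `|w ord0 i - s ord0 i| <= e) -> K w) ->
  [/\ forall i, (i < k)%N -> e <= seq_of_row s i,
      forall j, (j < m)%N -> `|seq_of_row s (k + j)%N| <= seq_of_row s (k + m)%N - e,
      e <= seq_of_row s (k + m)%N &
      \sum_(i < k) seq_of_row s i + seq_of_row s (k + m)%N <= 1 - e].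
Proof.
move=> e0 eK; pose t := seq_of_row s.
have shift (c : nat -> R) : (forall i, `|c i| <= 1) ->
    seq_body k m 1 (fun i => t i + e * c i).
  move=> c1; rewrite -cone_body_row; apply: eK => i.
  rewrite row_of_seqE -seq_of_rowE -/t addrAC subrr add0r normrM (gtr0_norm e0).
  by rewrite ler_piMr// ltW.
pose top (b : R) i : R := if i == (k + m)%N then b else 0.
have top1 b : `|b| <= 1 -> forall i, `|top b i| <= 1.
  by move=> b1 i; rewrite /top; case: ifP => _ //; rewrite normr0.
have topE b : top b (k + m)%N = b by rewrite /top eqxx.
have topN b i : (i < k + m)%N -> top b i = 0 by rewrite /top; case: eqP => //; lia.
have N1 : `|-1 : R| <= 1 by rewrite normrN1.
have P1 : `|1 : R| <= 1 by rewrite normr1.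
have [y1 _ _ _] := shift (fun=> -1) (fun=> N1).
have [_ y2 y3 _] := shift _ (top1 _ N1).
have [_ _ _ y4] := shift _ (top1 _ P1).
split.
- by move=> i /y1; rewrite /= -/t; lra.
- move=> j jm; have := y2 _ jm; rewrite topE topN; last by lia.
  by rewrite mulr0 addr0 -/t; lra.
- by move: y3; rewrite topE -/t; lra.
move: y4; rewrite topE (eq_bigr (fun i : 'I_k => t i)); first by rewrite -/t; lra.
by move=> i _; rewrite topN ?mulr0 ?addr0//; have := ltn_ord i; lia.
Qed.

Lemma vol_cone_body_fin : vol K \is a fin_num.
Proof. by rewrite vol_cone_body body_moment_fin. Qed.

Lemma vol_cone_body_gt0 : (0 < vol K)%E.
Proof.
have [c /interior_boxP[e e0 eK]] := cone_body_interior k m (R := R).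
apply: lt_le_trans (vol_box_ge (ltW e0) eK).
by rewrite lte_fin exprn_gt0// mulr_gt0.
Qed.

(** Coordinates of points of [K - s] are at most 2 in absolute value, so the polar contains the cube
    of radius [1 / (2 n)]. *)
Lemma vol_polar_gt0 s : K s -> (0 < vol (polar (translate K s)))%E.
Proof.
move=> Ks; pose r : R := (2 * n%:R)^-1.
have r0 : 0 < r by rewrite invr_gt0 mulr_gt0.
apply: lt_le_trans (@vol_box_ge _ _ _ 0 r (ltW r0) _).
  by rewrite lte_fin exprn_gt0// mulr_gt0.
move=> v vr _ [z Kz <-]; apply: le_trans (ler_norm _) _.
apply: le_trans (ler_norm_sum _ _ _) _.
apply: (@le_trans _ _ (\sum_(i < n) (r * 2))); last first.
  rewrite sumr_const card_ord -[X in X <= _]mulr_natr -mulrA mulVf ?lexx//.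
apply: ler_sum => i _; rewrite normrM; apply: ler_pM => //.
  by have := vr i; rewrite mxE subr0.
rewrite mxE [X in _ + X]mxE; apply: le_trans (ler_normB _ _) _.
by have := cone_body_bound Kz i; have := cone_body_bound Ks i; lra.
Qed.

(** The points [s + e e_i] and [s - e e_i] lie in [K], which bounds each coordinate of a polar
    vector by [1 / e]. *)
Lemma vol_polar_fin s : interior K s ->
  vol (polar (translate K s)) \is a fin_num.
Proof.
move=> /interior_boxP[e e0 eK]; rewrite ge0_fin_numE ?vol_ge0//.
have ei0 : 0 <= e^-1 by rewrite invr_ge0 ltW.
apply: le_lt_trans (@vol_box_le _ _ _ e^-1 ei0 _) (ltry _) => v pv i.
have bnd (c : R) : `|c| <= e -> c * v ord0 i <= 1.
  move=> ce; rewrite -dotp_delta -dotpZr; apply: pv.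
  exists (s + c *: delta_mx ord0 i); last by rewrite addrAC subrr add0r.
  apply: eK => j; rewrite !mxE eqxx/= addrAC subrr add0r.
  by case: eqP => _; rewrite ?mulr1// mulr0 normr0 ltW.
rewrite ler_norml -[e^-1]mulr1 -mulrN ler_pdivlMl// ler_pdivrMl//.
have := bnd e; have := bnd (- e); rewrite normrN (gtr0_norm e0) lexx.
by move=> /(_ isT) + /(_ isT); rewrite mulNr => ? ?; apply/andP; split; lra.
Qed.

(** * Comparing the polars at a point and at its projective image *)

Section comparison.
Variable s : 'rV[R]_n.
Let t := seq_of_row s.
Let h := t (k + m)%N.
Let Z := 1 - h / 2.
Let d (i : nat) : R := if (i < k)%N then 1 else 2^-1.
(** The image of [s] under the projective automorphism of [K]; [Z] is the denominator at [s], and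
    [d] halves the coordinates [x] and [h]. *)
Definition shrunk_point : 'rV[R]_n := row_of_seq n (fun i => d i * t i / Z).
Let s' := shrunk_point.

Let D v : 'rV[R]_n := \row_i (d i * v ord0 i).

Let D_dotp v w : dotp (D v) w = dotp v (D w).
Proof. by apply: eq_bigr => i _; rewrite !mxE mulrCA mulrA. Qed.

Let d_ge0 i : 0 <= d i. Proof. by rewrite /d; case: ifP; rewrite ?invr_ge0. Qed.

Let d_last : d (k + m)%N = 2^-1.
Proof. by rewrite /d ifF//; lia. Qed.

Hypothesis Ks : interior K s.

Let h01 : 0 < h /\ h <= 1.
Proof.
have [e e0 eK] := (interior_boxP _ _).1 Ks.
have [_ _ h0 _] := cone_body_slack e0 eK; split; first by rewrite /h /t; lra.
have /cone_body_bound/(_ ord_max) : K s by exact: interior_subset.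
by rewrite -seq_of_rowE; apply: le_trans; exact: ler_norm.
Qed.

Let Z0 : 0 < Z. Proof. by rewrite /Z; have := h01; lra. Qed.

(** Slack [e] of [s] leaves slack [e / 2] at the image, because the halved coordinates lose at most
    a factor 2 and [Z <= 1]. *)
Lemma shrunk_point_interior : interior K s'.
Proof.
have [h0 h1] := h01.
have [e e0 eK] := (interior_boxP _ _).1 Ks.
have [y1 y2 y3 y4] := cone_body_slack e0 eK; rewrite -/t -/h in y1 y2 y3 y4.
have Z1 : Z <= 1 by rewrite /Z; lra.
pose e' := e / 2.
pose r := e' / 2 / k.+1%:R.
have r0 : 0 < r by rewrite divr_gt0 ?ltr0n// !divr_gt0.
have rk : k.+1%:R * r = e' / 2 by rewrite mulrC divfK// pnatr_eq0.
have kr : 0 <= k%:R * r by rewrite mulr_ge0// ltW.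
have Zi0 : 0 < Z^-1 by rewrite invr_gt0.
have divZ (x y : R) : x * Z <= y -> x <= y / Z by rewrite ler_pdivlMr.
have tail j : d (k + j)%N = 2^-1 by rewrite /d ifF//; lia.
apply/interior_boxP; exists r => // w ws.
apply: (@seq_body_near _ k m (fun i => d i * t i / Z) _ e' r) => //.
- move=> i ik; apply: divZ; rewrite /d ik mul1r.
  by apply: le_trans (y1 _ ik); apply: (@le_trans _ _ e'); rewrite ?ler_piMr// /e'; lra.
- move=> j jm; rewrite !tail !normrM (gtr0_norm Zi0) ler_pdivrMr//.
  rewrite mulrBl divfK ?gt_eqF//.
  have := y2 _ jm; rewrite ger0_norm// -/h => H.
  have : e' * Z <= e' by rewrite ler_piMr// /e'; lra.
  by rewrite /e'; lra.
- apply: divZ; rewrite tail -/h.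
  have : e' * Z <= e' by rewrite ler_piMr// /e'; lra.
  by rewrite /e'; lra.
- rewrite tail -/h (eq_bigr (fun i : 'I_k => t i / Z)); last first.
    by move=> i _; rewrite /d ltn_ord mul1r.
  rewrite -mulr_suml -mulrDl ler_pdivrMr//.
  have : e' * Z <= e' by rewrite ler_piMr// /e'; lra.
  by move: y4; rewrite /Z /e'; lra.
- by move: rk; rewrite -natr1; lra.
- by rewrite rk /e'; lra.
move=> i ilt; have := ws (Ordinal ilt).
by rewrite -seq_of_rowE row_of_seqE.
Qed.

(** All constraints but the last are homogeneous, and [sum y + h <= 1] is the same as
    [sum y + h/2 <= 1 - h/2]. *)
Lemma cone_body_projective v : K v ->
  K ((1 - v ord0 ord_max / 2)^-1 *: D v).
Proof.
move=> Kv; pose u := seq_of_row v; pose hv := u (k + m)%N.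
have hvE : v ord0 ord_max = hv by rewrite -seq_of_rowE.
rewrite hvE; set z := 1 - hv / 2.
have := Kv => -[y1 y2 y3 y4]; rewrite -/u -/hv in y1 y2 y3 y4.
have y5 : hv <= 1.
  by have := cone_body_bound Kv ord_max; rewrite hvE; apply: le_trans; exact: ler_norm.
have z0 : 0 < z by rewrite /z; lra.
have -> : z^-1 *: D v = row_of_seq n (fun i => z^-1 * (d i * u i)).
  by apply/rowP => i; rewrite !mxE /u seq_of_rowE.
have tail j : d (k + j)%N = 2^-1 by rewrite /d ifF//; lia.
have zi0 : 0 < z^-1 by rewrite invr_gt0.
rewrite cone_body_row; split.
- by move=> i ik; rewrite !mulr_ge0// ?y1// ltW.
- move=> j jm; rewrite !tail !normrM (gtr0_norm zi0) ger0_norm//.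
  by rewrite !ler_pM2l//; exact: y2.
- by rewrite !mulr_ge0// ltW.
rewrite -mulr_sumr -mulrDr mulrC ler_pdivrMr// tail mul1r.
rewrite (eq_bigr (fun i : 'I_k => u i)); first by rewrite -/hv /z; lra.
by move=> i _; rewrite /d ltn_ord mul1r.
Qed.

(* The linear map of the dual cone of [K] induced by the projective
   automorphism [v |-> D v / (1 - h(v)/2)] of [K]. *)
Lemma polar_shrunk_point g : polar (translate K s') g ->
  polar (translate K s)
    (Z^-1 *: (D g + (2^-1 * (1 + dotp g s')) *: delta_mx ord0 ord_max)).
Proof.
move=> pg _ [v Kv <-].
have [h0 h1] := h01.
have tE : s ord0 ord_max = h by rewrite -seq_of_rowE.
have DsE : D s = Z *: s'.
  apply/rowP => i; rewrite !mxE -seq_of_rowE -/t.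
  by rewrite [RHS]mulrC divfK// gt_eqF.
have := pg _ (ex_intro2 _ _ _ (cone_body_projective Kv) erefl).
rewrite dotpBr dotpZr; set z := 1 - _ / 2; set A := dotp g s' => H.
have z0 : 0 < z.
  have := cone_body_bound Kv ord_max; rewrite ler_norml => /andP[_].
  by rewrite /z; lra.
(* Clearing the denominator turns the polar inequality at the image of [v] into one that is affine
   in [v]. *)
have {}H : dotp g (D v) <= z * (1 + A).
  by rewrite -ler_pdivrMl//; lra.
rewrite dotpC dotpZr dotpDr dotpZr dotp_delta dotpC D_dotp.
rewrite (_ : D (v - s) = D v - Z *: s'); last first.
  by rewrite -DsE; apply/rowP => i; rewrite !mxE mulrBr.
rewrite dotpBr dotpZr -/A mulrC ler_pdivrMr// mul1r 2!mxE tE.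
by move: H; rewrite /z /Z; lra.
Qed.

Lemma vol_polar_shrunk_point : (vol (polar (translate K s')) <=
  (Z ^+ n.+1 * 2 ^+ m.+1)%:E * vol (polar (translate K s)))%E.
Proof.
have [h0 h1] := h01.
(* Diagonal of the dual map. In its last entry [(1 + h / (2 Z)) / (2 Z)] simplifies because
   [Z + h/2 = 1]; the term [dotp g s'] puts the other coordinates into the last shift. *)
pose a i := if (i < k + m)%N then d i / Z else (2 * Z ^+ 2)^-1.
pose b i (g : nat -> R) := if (i < k + m)%N then 0 else
  (2 * Z)^-1 * (1 + \sum_(j < k + m) g j * seq_of_row s' j).
have d0 i : 0 < d i by rewrite /d; case: ifP; rewrite ?invr_gt0.
have a0 i : 0 < a i.
  rewrite /a; case: ifP => _; first by rewrite divr_gt0.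
  by rewrite invr_gt0 mulr_gt0// exprn_gt0.
have bP i : depends_below i (b i).
  move=> g g' gg'; rewrite /b; case: ifP => // ikm.
  by congr (_ * (1 + _)); apply: eq_bigr => j _; rewrite gg'//; have := ltn_ord j; lia.
have prodE : (\prod_(i < n) a i)^-1 = Z ^+ n.+1 * 2 ^+ m.+1.
  rewrite big_ord_recr/= [a (k + m)%N]/a ltnn.
  rewrite (eq_bigr (fun i : 'I_(k + m) => d i / Z)); last first.
    by move=> i _; rewrite /a ltn_ord.
  rewrite big_split/= prodr_const card_ord big_split_ord/=.
  rewrite big1 => [|i _]; last by rewrite /d ltn_ord.
  rewrite (eq_bigr (fun=> 2^-1)); last by move=> i _; rewrite /d ifF//; lia.
  rewrite prodr_const card_ord mul1r !exprVn -!invfM invrK.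
  by rewrite !(exprS _ _.+1) (exprS _ m) (exprS _ (k + m)); ring.
rewrite /vol -prodE.
rewrite -(iint_triangular a0 bP (@row_depends _ _ _) (fun=> indic_ge0E _ _)).
apply: le_iint => g; first exact: indic_ge0E.
rewrite lee_fin; apply: le_indic => /polar_shrunk_point.
congr polar; apply/rowP => i; rewrite row_of_seqE !mxE eqxx/= /a /b.
have [ikm|] := ltnP i (k + m)%N.
  rewrite (_ : (i == ord_max) = false); last first.
    by apply/eqP => iE; move: ikm; rewrite iE/= ltnn.
  by rewrite mulr0 !addr0; ring.
move=> kmi; have {kmi}-> : i = ord_max.
  by apply/val_inj => /=; have := ltn_ord i; lia.
rewrite eqxx mulr1 /= d_last /dotp big_ord_recr/=.
rewrite (eq_bigr (fun j : 'I_(k + m) => g j * seq_of_row s' j)); last first.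
  move=> j _; rewrite row_of_seqE/=; congr (_ * _).
  by rewrite -seq_of_rowE.
set S := \sum_(j < k + m) _.
rewrite !row_of_seqE/= d_last -/h /Z.
by field; apply: lt0r_neq0; lra.
Qed.

End comparison.

(** The volume of [K] cancels, so minimality at [s] against its image gives
    [1 <= (1 - h/2)^(n+1) * 2^(m+1)]. Bounding [1 - h/2] by [exp (-h/2)] and 2 by [exp 1] compares
    exponents. *)
Lemma santalo_height s : santalo_point K s ->
  (k + m).+2%:R * s ord0 ord_max <= 2 * m.+1%:R.
Proof.
move=> [Ks smin].
have := smin _ (shrunk_point_interior Ks).
rewrite !vol_translate.
rewrite lee_pmul2l ?vol_cone_body_fin ?vol_cone_body_gt0//.
move=> /le_trans /(_ (vol_polar_shrunk_point Ks)).
have pos := vol_polar_gt0 (interior_subset Ks).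
rewrite -{1}[X in (X <= _)%E]mul1e.
rewrite lee_pmul2r ?vol_polar_fin// lee_fin.
rewrite (_ : seq_of_row s (k + m)%N = s ord0 ord_max); last by rewrite -seq_of_rowE.
set h := s ord0 ord_max => H.
have {}H : 1 <= expR (- (h / 2) * n.+1%:R + m.+1%:R).
  apply: le_trans H _; rewrite exp.expRD; apply: ler_pM.
  - rewrite exprn_ge0// subr_ge0.
    have := cone_body_bound (interior_subset Ks) ord_max.
    by rewrite ler_norml -/h => /andP[_]; lra.
  - by rewrite exprn_ge0.
  - rewrite [X in expR X]mulrC expRM_natl; apply: lerXn2r; rewrite ?nnegrE ?expR_ge0//.
      have := cone_body_bound (interior_subset Ks) ord_max.
      by rewrite ler_norml -/h => /andP[_]; lra.
    exact: expR_ge1Dx.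
  - rewrite -[m.+1%:R]mulr1 expRM_natl; apply: lerXn2r; rewrite ?nnegrE ?expR_ge0//.
    by have := expR_ge1Dx (1 : R); lra.
by move: H; rewrite -[leLHS]exp.expR0 ler_expR; lra.
Qed.

End santalo.

(** * Polytopes and their vertices *)

Section polytope_vertices.
Context {R : realType} {n : nat}.
Implicit Types (P : set 'rV[R]_n) (V : seq 'rV[R]_n).

(* Unlike [conv_hull], weights are attached to vectors, not to positions. *)
Definition hull V : set 'rV[R]_n :=
  [set x | exists w : 'rV[R]_n -> R, [/\ forall v, 0 <= w v,
     \sum_(v <- V) w v = 1 & x = \sum_(v <- V) w v *: v]].

Lemma conv_hull_sub_hull V : conv_hull V `<=` hull (undup V).
Proof.
move=> _ [w [w0 [w1 ->]]].
have mem_nthV (i : 'I_(size V)) : V`_i \in undup V by rewrite mem_undup mem_nth.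
exists (fun v => \sum_(i < size V | v == V`_i) w i); split.
- by move=> v; apply: sumr_ge0.
- rewrite -w1 (exchange_big_dep predT)//=; apply: eq_bigr => i _.
  by rewrite -big_filter filter_pred1_uniq ?undup_uniq// big_seq1.
under [RHS]eq_bigr => v _ do rewrite scaler_suml.
rewrite (exchange_big_dep predT)//=; apply: eq_bigr => i _.
by rewrite -[RHS]big_filter filter_pred1_uniq ?undup_uniq// big_seq1.
Qed.

Lemma conv_hull_mem V v : v \in V -> conv_hull V v.
Proof.
move=> vV; have iV : (index v V < size V)%N by rewrite index_mem.
exists (fun i => (i == Ordinal iV)%:R); split => //; split.
  by rewrite (bigD1 (Ordinal iV))//= eqxx big1 ?addr0// => i /negbTE ->.
rewrite (bigD1 (Ordinal iV))//= eqxx scale1r nth_index//.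
by rewrite big1 ?addr0// => i /negbTE ->; rewrite scale0r.
Qed.

(** Solving [v = sum c u *: u] for [v] expresses it by the other vectors with weights
    [c u / (1 - c v)]; the weight of [v] is redistributed accordingly. *)
Lemma hull_rem V v (c : 'rV[R]_n -> R) : v \in V -> (forall u, 0 <= c u) ->
  \sum_(u <- V) c u = 1 -> v = \sum_(u <- V) c u *: u -> c v < 1 ->
  hull V `<=` hull (rem v V).
Proof.
move=> vV c0 c1 vE cv1 _ [w [w0 w1 ->]].
have cv0 : 1 - c v != 0 by rewrite gt_eqF// subr_gt0.
pose b := w v / (1 - c v).
exists (fun u => w u + b * c u); split.
- by move=> u; rewrite addr_ge0// mulr_ge0// divr_ge0// subr_ge0 ltW.
- move: w1 c1; rewrite !(big_rem v vV)/= big_split/= -mulr_sumr => w1 c1.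
  have -> : \sum_(u <- rem v V) c u = 1 - c v by lra.
  by rewrite /b divfK//; lra.
rewrite (big_rem v vV)/=.
under [RHS]eq_bigr => u _ do rewrite scalerDl -scalerA.
rewrite big_split/= -scaler_sumr addrC; congr (_ + _).
have -> : \sum_(u <- rem v V) c u *: u = (1 - c v) *: v.
  by rewrite scalerBl scale1r {2}vE (big_rem v vV)/= addrAC subrr add0r.
by rewrite scalerA divfK.
Qed.

(** A generating list of least size consists of vertices. If [v] lies strictly between [x] and [y]
    in [P], mixing their weights represents [v] over the list; were its own weight below 1, [v]
    could be removed. *)
Lemma polytope_vertices P : polytope P ->
  exists V, [/\ uniq V, forall v, v \in V -> vertex P v & P `<=` hull V].
Proof.
move=> [V0 PV0].
pose good V := [/\ uniq V, forall v, v \in V -> P v & P `<=` hull V].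
have exgood : exists N, `[< exists2 V, good V & size V = N >].
  exists (size (undup V0)); apply/asboolP; exists (undup V0) => //; split.
  - exact: undup_uniq.
  - by move=> v; rewrite mem_undup PV0; exact: conv_hull_mem.
  - by rewrite PV0; exact: conv_hull_sub_hull.
case: (ex_minnP exgood) => N /asboolP[V [uV VP PV] sV] minN.
exists V; split => // v vV; split; first exact: VP.
move=> x y t Px Py t0 t1 vE.
have [w [w0 w1 xE]] := PV _ Px; have [z [z0 z1 yE]] := PV _ Py.
pose c u := t * w u + (1 - t) * z u.
have t1' : 0 < 1 - t by rewrite subr_gt0.
have c0 u : 0 <= c u by rewrite addr_ge0// mulr_ge0// ltW.
have c1 : \sum_(u <- V) c u = 1.
  by rewrite big_split/= -!mulr_sumr w1 z1; lra.
have vcE : v = \sum_(u <- V) c u *: u.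
  rewrite {1}vE {1}xE {1}yE !scaler_sumr -big_split/=; apply: eq_bigr => u _.
  by rewrite !scalerA -scalerDl.
have cv1 : 1 <= c v.
  rewrite leNgt; apply/negP => cv1.
  have : (N <= size (rem v V))%N.
    apply: minN; apply/asboolP; exists (rem v V) => //; split.
    - exact: rem_uniq.
    - by move=> u /mem_rem; exact: VP.
    - by apply: subset_trans PV _; exact: (hull_rem vV c0 c1 vcE cv1).
  by rewrite size_rem// sV; move: vV; rewrite -sV; case: (V) => //= *; lia.
(* [c v >= 1] forces both weight systems to be concentrated at [v]. *)
have only (f : 'rV[R]_n -> R) : (forall u, 0 <= f u) -> \sum_(u <- V) f u = 1 ->
    1 <= f v -> \sum_(u <- V) f u *: u = v.
  move=> f0; rewrite !(big_rem v vV)/= => f1 fv.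
  have s0 : 0 <= \sum_(u <- rem v V) f u by apply: sumr_ge0.
  have fv1 : f v = 1 by lra.
  have /eqP : \sum_(u <- rem v V) f u = 0 by lra.
  rewrite psumr_eq0// => /allP f_eq0.
  rewrite fv1 scale1r big1_seq ?addr0// => u /andP[_ /f_eq0/= /eqP ->].
  by rewrite scale0r.
have le1 (f : 'rV[R]_n -> R) : (forall u, 0 <= f u) -> \sum_(u <- V) f u = 1 ->
    f v <= 1.
  move=> f0; rewrite (big_rem v vV)/= => <-; rewrite lerDl.
  by apply: sumr_ge0.
have wv := le1 _ w0 w1; have zv := le1 _ z0 z1.
move: cv1; rewrite /c => cv1.
split; [rewrite xE; apply: only => //|rewrite yE; apply: only => //]; nra.
Qed.

End polytope_vertices.

(** * Counting vertices *)

Section sign_vectors.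
Context {R : realType} (m : nat).
Implicit Types (sigma : {ffun 'I_m -> bool}) (u : 'I_m -> R).

Definition sign_dot sigma u : R := \sum_(j < m) (-1) ^+ sigma j * u j.

(** A uniform form on [[-1, 1]] of [cosh x <= exp (x^2 / 2)]: first [cosh x <= cosh 1], then a
    numerical estimate of [q = exp (1/2)]. *)
Lemma expR_cosh_le (x : R) : `|x| <= 1 ->
  expR x + expR (- x) <= 2 * expR 2^-1.
Proof.
rewrite ler_norml => /andP[x1 x2].
set q := expR (2^-1 : R).
have q0 : 0 < q by exact: expR_gt0.
have le_chord : expR x + expR (- x) <= q ^+ 2 + (q ^+ 2)^-1.
  have eE : q ^+ 2 = expR 1 by rewrite -expRM_natl divff.
  rewrite eE -expRN.
  (* Expanded, this product says exactly that [cosh x <= cosh 1]. *)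
  have : 0 <= (expR 1 - expR x) * (1 - expR (- 1 - x)).
    apply: mulr_ge0; first by rewrite subr_ge0 ler_expR.
    by rewrite subr_ge0 -[leRHS]exp.expR0 ler_expR; lra.
  rewrite mulrBr mulr1 mulrBl -!exp.expRD.
  rewrite (_ : 1 + (-1 - x) = - x); last by ring.
  by rewrite (_ : x + (-1 - x) = -1); [lra|ring].
have q32 : 3 / 2 <= q by have := expR_ge1Dx (2^-1 : R); rewrite -/q; lra.
have q12 : q <= (8 / 7) ^+ 4.
  have -> : q = expR (8^-1) ^+ 4 by rewrite -expRM_natl; congr expR; lra.
  apply: lerXn2r; rewrite ?nnegrE ?expR_ge0//.
  have : 7 / 8 <= expR (- 8^-1 : R) by have := expR_ge1Dx (- 8^-1 : R); lra.
  rewrite expRN => H; rewrite -[leLHS]invrK -[leRHS]invrK.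
  by rewrite lef_pV2 ?posrE ?invr_gt0 ?expR_gt0// invf_div.
have qi : (q ^+ 2)^-1 <= 4 / 9.
  rewrite -[leRHS]invrK lef_pV2 ?posrE ?exprn_gt0// invf_div; nra.
apply: le_trans le_chord _.
have {}q12 : q <= 1 + 71 / 100 by apply: le_trans q12 _; lra.
nra.
Qed.

Lemma sum_expR_sign_dot u : \sum_sigma expR (sign_dot sigma u) =
  \prod_(j < m) (expR (u j) + expR (- u j)).
Proof.
have E j : expR (u j) + expR (- u j) = \sum_(b : bool) expR ((-1) ^+ b * u j).
  by rewrite big_bool/= expr0 expr1 mul1r mulN1r addrC.
under [RHS]eq_bigr do rewrite E.
rewrite bigA_distr_bigA/=; apply: eq_bigr => sigma _.
by rewrite expR_sum.
Qed.

(** Chernoff's bound with parameter 1: the threshold contributes [exp (-3m/4)], the exponential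
    moment at most [2^m exp (m/2)]. *)
Lemma sign_cap_count u : (forall j, `|u j| <= 1) ->
  \sum_sigma ((3 / 4 * m%:R < sign_dot sigma u)%R%:R : R) <=
  2 ^+ m * expR (- (m%:R / 4)).
Proof.
move=> u1.
apply: (@le_trans _ _ (\sum_sigma expR (- (3 / 4 * m%:R)) * expR (sign_dot sigma u))).
  apply: ler_sum => sigma _; rewrite -exp.expRD.
  case: ltP => [lt|_]; last exact: expR_ge0.
  by rewrite /= -[leLHS]exp.expR0 ler_expR; lra.
rewrite -mulr_sumr sum_expR_sign_dot.
have le_pow : \prod_(j < m) (expR (u j) + expR (- u j)) <= (2 * expR 2^-1) ^+ m.
  rewrite -[m in leRHS]card_ord -prodr_const; apply: ler_prod => j _.
  by rewrite addr_ge0 ?expR_ge0//= expR_cosh_le.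
apply: le_trans (ler_wpM2l (expR_ge0 _) le_pow) _.
rewrite exprMn -expRM_natl mulrCA -exp.expRD.
by rewrite ler_pM2l ?exprn_gt0// ler_expR; lra.
Qed.

(** Of [sigma] and its negation at least one has nonnegative inner product with [u]. *)
Lemma sign_half_count u :
  2 ^+ m <= 2 * \sum_sigma ((0 <= sign_dot sigma u)%R%:R : R).
Proof.
pose neg sigma : {ffun 'I_m -> bool} := [ffun j => ~~ sigma j].
have negK : involutive neg by move=> sigma; apply/ffunP => j; rewrite !ffunE negbK.
have negE sigma : sign_dot (neg sigma) u = - sign_dot sigma u.
  rewrite -sumrN; apply: eq_bigr => j _; rewrite ffunE -mulNr.
  by case: (sigma j); rewrite /= ?expr0 ?expr1 ?opprK.
rewrite mulr_natl [leRHS]mulr2n {1}(reindex_inj (inv_inj negK))/= -big_split/=.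
apply: (@le_trans _ _ (\sum_(sigma : {ffun 'I_m -> bool}) 1)).
  by rewrite sumr_const card_ffun card_bool card_ord -natrX.
apply: ler_sum => sigma _; rewrite negE oppr_ge0.
by have [_|/ltW ->] := leP (sign_dot sigma u) 0; rewrite ?lerDl ?lerDr ler0n.
Qed.

End sign_vectors.

(** * Each sign vector selects a vertex; each vertex serves few sign vectors *)

Section counting.
Context {R : realType} (k m : nat).
Notation n := (k + m).+1.
Notation K := (@cone_body R k m).
Implicit Types (v x xi : 'rV[R]_n) (V : seq 'rV[R]_n).
Implicit Types sigma : {ffun 'I_m -> bool}.

Definition cube_part x (j : 'I_m) : R := seq_of_row x (k + j)%N.

Lemma sign_dot_linear sigma (a : R) x v :
  sign_dot sigma (cube_part (a *: x + v)) =
  a * sign_dot sigma (cube_part x) + sign_dot sigma (cube_part v).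
Proof.
rewrite mulr_sumr -big_split/=; apply: eq_bigr => j _.
by rewrite /cube_part /seq_of_row !mxE; ring.
Qed.

Lemma sign_dot_sum sigma V (w : 'rV[R]_n -> R) :
  sign_dot sigma (cube_part (\sum_(v <- V) w v *: v)) =
  \sum_(v <- V) w v * sign_dot sigma (cube_part v).
Proof.
elim: V => [|v V IHV]; last by rewrite !big_cons sign_dot_linear IHV.
rewrite !big_nil /sign_dot big1// => j _.
by rewrite /cube_part /seq_of_row mxE mulr0.
Qed.

(** The index [k + m] of the height gives [m], which [insub] rejects, so the default 1 is the
    height. *)
Definition sign_vertex sigma : 'rV[R]_n := row_of_seq n (fun i =>
  if (i < k)%N then 0 else if insub (i - k)%N is Some j then (-1) ^+ sigma j else 1).

Lemma sign_vertexE sigma (s := seq_of_row (sign_vertex sigma)) :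
  [/\ forall i, (i < k)%N -> s i = 0,
      forall j : 'I_m, s (k + j)%N = (-1) ^+ sigma j & s (k + m)%N = 1].
Proof.
split.
- by move=> i ik; rewrite /s seq_of_rowK ?ik//; lia.
- move=> j; have := ltn_ord j => jm; rewrite /s seq_of_rowK; last by lia.
  by rewrite ifF ?addKn ?valK//; lia.
rewrite /s seq_of_rowK// ifF; last by lia.
by rewrite addKn insubF// ltnn.
Qed.

Lemma sign_vertex_body sigma : K (sign_vertex sigma).
Proof.
have [y0 xs h1] := sign_vertexE sigma; split.
- by move=> i /y0 ->.
- move=> j jm; have /= -> := xs (Ordinal jm); rewrite h1.
  by rewrite normrX normrN1 expr1n.
- by rewrite h1.
by rewrite h1 big1 ?add0r// => i _; rewrite y0.
Qed.

Lemma sign_vertex_dot sigma : sign_dot sigma (cube_part (sign_vertex sigma)) = m%:R.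
Proof.
have [_ xs _] := sign_vertexE sigma.
rewrite /sign_dot -[m in RHS]card_ord -sumr_const; apply: eq_bigr => j _.
by rewrite /cube_part xs -exprMn mulrNN mul1r expr1n.
Qed.

Section approximation.
Variables (xi : 'rV[R]_n) (P : set 'rV[R]_n) (V : seq 'rV[R]_n) (lambda : R).
Hypotheses (m0 : (0 < m)%N) (lambda1 : 1 <= lambda)
  (xi_low : 3 * lambda * xi ord0 ord_max < 1)
  (P_sub : P `<=` translate K xi) (sub_P : translate K xi `<=` dilate lambda P)
  (VP : forall v, v \in V -> P v) (PV : P `<=` hull V).

(** The cap condition is stated with the height multiplied out, so that it makes sense at height 0
    and is affine in [v]. *)
Let cap sigma v : bool := 3 / 4 * m%:R * (v + xi) ord0 ord_max <
  sign_dot sigma (cube_part (v + xi)).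

(** The affine function [phi] is positive on the cap. If no vector of [V] were in it, [phi] would be
    at most 0 at the contracted point [p], while [lambda * phi p] is at least
    [m - 3m/4 * (1 - h + lambda h)] with [h] the height of [xi]. *)
Lemma cap_exists sigma : 0 <= sign_dot sigma (cube_part xi) ->
  exists2 v, v \in V & cap sigma v.
Proof.
move=> xi0; have l1 := lambda1; have xl := xi_low; have l0 : 0 < lambda by lra.
have [p Pp pE] : dilate lambda P (sign_vertex sigma - xi).
  by apply: sub_P; exists (sign_vertex sigma) => //; exact: sign_vertex_body.
have [w [w0 w1 pwE]] := PV Pp.
have [//|noV] := pselect (exists2 v, v \in V & cap sigma v).
pose phi v := sign_dot sigma (cube_part (v + xi)) -
  3 / 4 * m%:R * (v + xi) ord0 ord_max.
have phi_le0 : \sum_(v <- V) w v * phi v <= 0.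
  rewrite big_seq; apply: sumr_le0 => v vV; apply: mulr_ge0_le0 => //.
  by rewrite subr_le0 leNgt; apply/negP => vc; apply: noV; exists v.
have phiE v : phi v = sign_dot sigma (cube_part v) +
    sign_dot sigma (cube_part xi) - 3 / 4 * m%:R * v ord0 ord_max
    - 3 / 4 * m%:R * xi ord0 ord_max.
  by rewrite /phi -[v in v + xi]scale1r sign_dot_linear !mxE; ring.
have phi_p : \sum_(v <- V) w v * phi v = phi p.
  pose c := sign_dot sigma (cube_part xi) - 3 / 4 * m%:R * xi ord0 ord_max.
  have -> : phi p = \sum_(v <- V) w v * sign_dot sigma (cube_part v) -
      3 / 4 * m%:R * (\sum_(v <- V) w v * v ord0 ord_max) + (\sum_(v <- V) w v) * c.
    rewrite w1 mul1r phiE pwE sign_dot_sum summxE.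
    by under [X in _ - _ * X - _]eq_bigr do rewrite mxE; rewrite /c; ring.
  rewrite mulr_sumr mulr_suml -sumrB -big_split/=; apply: eq_bigr => v _.
  by rewrite phiE /c; ring.
have Lp : lambda * sign_dot sigma (cube_part p) = m%:R - sign_dot sigma (cube_part xi).
  have := sign_dot_linear sigma lambda p xi.
  by rewrite pE subrK sign_vertex_dot => ->; ring.
have Hp : lambda * p ord0 ord_max = 1 - xi ord0 ord_max.
  have qH : sign_vertex sigma ord0 ord_max = 1.
    by have [_ _ qH] := sign_vertexE sigma; rewrite -seq_of_rowE.
  by have /rowP/(_ ord_max) := pE; rewrite mxE [RHS]mxE [X in _ + X]mxE qH.
exfalso; have : lambda * phi p <= 0.
  by rewrite -phi_p pmulr_rle0.
rewrite phiE.
rewrite (_ : lambda * _ = lambda * sign_dot sigma (cube_part p) +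
    lambda * sign_dot sigma (cube_part xi)
    - 3 / 4 * m%:R * (lambda * p ord0 ord_max)
    - 3 / 4 * m%:R * (lambda * xi ord0 ord_max)); last by ring.
rewrite Lp Hp.
set S := sign_dot _ _ in xi0 *; set h := xi _ _ in xl *.
have m1 : 0 < m%:R :> R by rewrite ltr0n.
have S_le : S <= lambda * S by rewrite ler_peMl.
(* For [h >= 0] the bracket is below [4/3] since [3 lambda h < 1]; for [h < 0] it is at most 1. *)
have : 3 / 4 * (1 - h + lambda * h) < 1.
  have [hp|hn] := leP 0 h; first by lra.
  have : (lambda - 1) * h <= 0 by rewrite mulr_ge0_le0 ?subr_ge0// ltW.
  by lra.
nra.
Qed.

Lemma cap_count v : v \in V -> \sum_sigma ((cap sigma v)%:R : R) <=
  2 ^+ m * expR (- (m%:R / 4)).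
Proof.
move=> vV; have [y Ky yE] := P_sub (VP vV).
have Kv : K (v + xi) by rewrite -yE subrK.
case: Kv => _ xh; set h := seq_of_row _ (k + m)%N in xh *.
have hE : (v + xi) ord0 ord_max = h by rewrite -seq_of_rowE.
(* At height 0 the cube part vanishes and the strict cap inequality fails for every [sigma]; at
   positive height division by it lands in the cube. *)
rewrite le_eqVlt => /predU1P[h0 _|h0 _].
  rewrite big1; first by rewrite mulr_ge0 ?expR_ge0// exprn_ge0.
  move=> sigma _; rewrite /cap hE -h0 mulr0 /sign_dot big1 ?ltxx// => j _.
  have -> : cube_part (v + xi) j = 0; last by rewrite mulr0.
  by apply/eqP; rewrite -normr_le0 h0; exact: xh.
pose u j := cube_part (v + xi) j / h.
have u1 j : `|u j| <= 1.
  by rewrite normrM normfV (gtr0_norm h0) ler_pdivrMr// mul1r xh.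
apply: le_trans (sign_cap_count u1); apply: ler_sum => sigma _.
rewrite /cap hE ler_nat.
have -> : sign_dot sigma u = sign_dot sigma (cube_part (v + xi)) / h.
  by rewrite mulr_suml; apply: eq_bigr => j _; rewrite mulrA.
by rewrite ltr_pdivlMr.
Qed.

(** Double counting of pairs of a sign vector and a vector of [V] whose cap condition it meets. *)
Lemma expR_le_size : expR (m%:R / 4 : R) <= 2 * (size V)%:R.
Proof.
have half := sign_half_count (cube_part xi).
have count : \sum_sigma ((0 <= sign_dot sigma (cube_part xi))%R%:R : R) <=
    (size V)%:R * (2 ^+ m * expR (- (m%:R / 4))).
  apply: (@le_trans _ _ (\sum_sigma \sum_(v <- V) ((cap sigma v)%:R : R))).
    apply: ler_sum => sigma _.
    have [/cap_exists[v vV vc]|_] := leP 0 (sign_dot sigma (cube_part xi)); last first.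
      by apply: sumr_ge0.
    by rewrite (big_rem v vV)/= vc lerDl; apply: sumr_ge0.
  rewrite exchange_big/=.
  set c := 2 ^+ m * _.
  have -> : (size V)%:R * c = \sum_(v <- V) c.
    by rewrite big_const_seq count_predT iter_addr addr0 mulr_natl.
  by rewrite big_seq [leRHS]big_seq; apply: ler_sum => v vV; exact: cap_count.
have e0 : 0 < 2 ^+ m :> R by rewrite exprn_gt0.
have /(le_trans half) :
  2 * (\sum_sigma ((0 <= sign_dot sigma (cube_part xi))%R%:R : R)) <=
  2 ^+ m * (2 * (size V)%:R * expR (- (m%:R / 4))).
  apply: le_trans (ler_wpM2l _ count) _; rewrite // le_eqVlt.
  by apply/orP; left; apply/eqP; ring.
rewrite -[leLHS]mulr1 ler_pM2l// expRN ler_pdivlMr ?expR_gt0// mul1r.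
done.
Qed.

End approximation.

End counting.

(** * Choice of the parameters and conclusion *)

Lemma coarse_approximation_lower_bound (R : realType) :
  exists C : R, 0 < C /\
  exists n0 : nat, forall n : nat, (n0 <= n)%N ->
  forall N : nat,
    C * (n%:R) ^+ 2 <= N%:R -> N%:R <= expR (n%:R / C) ->
  exists K : set 'rV[R]_n,
    convex_body K /\
    forall s : 'rV[R]_n, santalo_point K s ->
    forall xi : 'rV[R]_n, segment (barycenter K) s xi ->
    forall P : set 'rV[R]_n, polytope P ->
      P `<=` translate K xi ->
      translate K xi `<=` dilate (n%:R / (C * ln (N%:R))) P ->
      has_at_least_vertices P N.
Proof.
exists 100; split => //; exists 1%N => n n1 N N_ge N_le.
have n1R : 1 <= n%:R :> R by rewrite ler1n.
have N100 : 100 <= N%:R :> R by nra.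
have N0 : 0 < N%:R :> R by lra.
pose L : R := ln N%:R; rewrite -/L.
have NE : N%:R = expR L by rewrite /L lnK// posrE.
have L1 : 1 <= L.
  rewrite -ler_expR -NE; apply: le_trans N100.
  have : 1 / 2 <= expR (- 2^-1 : R) by have := expR_ge1Dx (- 2^-1 : R); lra.
  rewrite expRN -[leRHS]mul1r ler_pdivlMr ?expR_gt0// => e2.
  have -> : expR (1 : R) = expR 2^-1 ^+ 2 by rewrite -expRM_natl divff.
  by have := expR_gt0 (2^-1 : R); nra.
have Ln : L <= n%:R / 100 by rewrite -ler_expR -NE.
(* Thus [4 L + 4 < m <= 4 L + 5]. The lower bound makes [exp (m/4)] exceed [e N >= 2 N], paying for
   the factor 2 in the count; the upper one gives [m <= 9 L < n]. *)
pose m := Num.truncn (4 * L + 5).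
have mL : m%:R <= 4 * L + 5 by rewrite truncn_le//; lra.
have Lm : 4 * L + 4 < m%:R.
  by have := truncnS_gt (4 * L + 5); rewrite -/m -natr1; lra.
have m0 : (0 < m)%N by rewrite -(ltr_nat R); lra.
have mn : (m < n)%N by rewrite -(ltr_nat R); lra.
have [k nE] : exists k, n = (k + m).+1 by exists (n - m.+1)%N; lia.
clearbody m; subst n; exists (@cone_body R k m).
split; first exact: cone_body_convex_body.
move=> s sK xi [t t01 xiE] P polyP P_sub sub_P.
have [V [uV vV PV]] := polytope_vertices polyP.
(* Height is affine along the segment, so the weaker of the two endpoint bounds holds throughout. *)
have xi_le : (k + m).+2%:R * xi ord0 ord_max <= 2 * m.+2%:R.
  have := santalo_height sK; have := barycenter_height (R := R) k m.
  rewrite ler_pdivlMr// -xiE.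
  have -> (b : 'rV[R]_(k + m).+1) : ((1 - t) *: b + t *: s) ord0 ord_max =
      (1 - t) * b ord0 ord_max + t * s ord0 ord_max by rewrite !mxE.
  set b := barycenter _ _ _; set h := s _ _ => b_le h_le.
  have /andP[t0 t1] : 0 <= t <= 1 by move: t01; rewrite /= in_itv.
  have mm : 2 * m.+1%:R <= 2 * m.+2%:R :> R by rewrite ler_pM2l// ler_nat.
  have m2 : 0 <= m.+2%:R :> R by [].
  rewrite [leLHS](_ : _ =
    (1 - t) * (b * (k + m).+2%:R) + t * ((k + m).+2%:R * h)); last by ring.
  have := ler_wpM2l t0 (le_trans h_le mm).
  have t1' : 0 <= 1 - t by lra.
  have := ler_wpM2l t1' b_le; nra.
have lam1 : 1 <= (k + m).+1%:R / (100 * L) by rewrite ler_pdivlMr; lra.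
(* For nonnegative height, [n] times it is at most [2 (m + 2) <= 8 L + 14 <= 22 L], and
   [3 * 22 < 100]. *)
have xi_low : 3 * ((k + m).+1%:R / (100 * L)) * xi ord0 ord_max < 1.
  rewrite mulrA mulrAC ltr_pdivrMr; last by lra.
  have [h0|h0] := leP 0 (xi ord0 ord_max).
    by move: xi_le; rewrite -(natr1 (k + m).+1) -(natr1 m.+1) -(natr1 m); lra.
  by apply: (@lt_trans _ _ 0); [rewrite nmulr_llt0// mulr_gt0|]; lra.
have VP v : v \in V -> P v by move=> /vV[].
have sizeV := expR_le_size m0 lam1 xi_low P_sub sub_P VP PV.
have NV : (N <= size V)%N.
  rewrite -(ler_nat R) NE.
  have : expR (L + 1) <= expR (m%:R / 4 : R) by rewrite ler_expR; lra.
  have := expR_ge1Dx (1 : R); have := expR_gt0 L; rewrite exp.expRD; nra.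
exists (take N V); split; first exact: take_uniq.
by split; [exact: size_takel|move=> v /mem_take/vV].
Qed.

Theorem theorem1p1 :
  exists C : Rdefinitions.R, 0 < C /\
  exists n0 : nat, forall n : nat, (n0 <= n)%N ->
  forall N : nat,
    C * (n%:R) ^+ 2 <= N%:R -> N%:R <= expR (n%:R / C) ->
  exists K : set 'rV[Rdefinitions.R]_n,
    convex_body K /\
    forall s : 'rV[Rdefinitions.R]_n, santalo_point K s ->
    forall xi : 'rV[Rdefinitions.R]_n, segment (barycenter K) s xi ->
    forall P : set 'rV[Rdefinitions.R]_n, polytope P ->
      P `<=` translate K xi ->
      translate K xi `<=` dilate (n%:R / (C * ln (N%:R))) P ->
      has_at_least_vertices P N.
Proof. exact: coarse_approximation_lower_bound. Qed.
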